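(* For each $n$, let $\mathbf{X}=(X_1,\dots,X_n)^\top$ follow the Ising model $\mathbb{P}_{\mathbf{Q},\boldsymbol{\mu}}$ on $\{\pm1\}^n$, where $\mathbf{Q}=\mathbf{Q}_n$ is a sequence of symmetric hollow matrices such that $\|\mathbf{Q}\|_{\ell_\infty\to\ell_\infty}=O(1)$. Consider testing $H_0:\boldsymbol{\mu}=\mathbf{0}$ versus $H_1:\boldsymbol{\mu}\in\Xi(s,B)$, where $s=s_n$ and $B=B_n$ may depend on $n$. Let $$\tilde X=\frac1n\sum_{i=1}^n\big[X_i-\tanh(m_i(\mathbf{X}))\big],\qquad m_i(\mathbf{X})=\sum_{j=1}^n\mathbf{Q}_{ij}X_j.$$ If $s\tanh(B)\gg n^{1/2}$, then the test that rejects $H_0$ if and only if $\sqrt n\,\tilde X\ge L_n$, for any $L_n\to\infty$ such that $L_n=o(n^{-1/2}s\tanh(B))$, is asymptotically powerful.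
   Context: The Ising model with parameters $\mathbf{Q}$ (an $n\times n$ real symmetric matrix which is hollow, i.e. has zero diagonal) and $\boldsymbol{\mu}=(\mu_1,\dots,\mu_n)^\top\in\mathbb{R}^n$ is the probability distribution on $\{\pm1\}^n$ $$\mathbb{P}_{\mathbf{Q},\boldsymbol{\mu}}(\mathbf{X}=\mathbf{x})=\frac{1}{Z(\mathbf{Q},\boldsymbol{\mu})}\exp\Big(\tfrac12\mathbf{x}^\top\mathbf{Q}\mathbf{x}+\boldsymbol{\mu}^\top\mathbf{x}\Big),\qquad \mathbf{x}\in\{\pm1\}^n,$$ where $Z(\mathbf{Q},\boldsymbol{\mu})$ is the normalizing constant. The operator norm is $\|\mathbf{Q}\|_{\ell_\infty\to\ell_\infty}=\max_{\|x\|_{\ell_\infty}\le1}\|\mathbf{Q}x\|_{\ell_\infty}=\max_{1\le i\le n}\sum_{j=1}^n|\mathbf{Q}_{ij}|$. For $s\in\{1,\dots,n\}$ and $B>0$, $$\Xi(s,B)=\Big\{\boldsymbol{\mu}\in\mathbb{R}^n: |\mathrm{supp}(\boldsymbol{\mu})|=s,\ \min_{i\in\mathrm{supp}(\boldsymbol{\mu})}\mu_i\ge B\Big\},\qquad \mathrm{supp}(\boldsymbol{\mu})=\{1\le i\le n:\mu_i\neq0\}.$$ A test is a function $T:\{\pm1\}^n\to\{0,1\}$, where the value $1$ means rejecting $H_0$. Its worst-case risk is $$\mathrm{Risk}(T)=\mathbb{P}_{\mathbf{Q},\mathbf{0}}(T(\mathbf{X})=1)+\sup_{\boldsymbol{\mu}\in\Xi(s,B)}\mathbb{P}_{\mathbf{Q},\boldsymbol{\mu}}(T(\mathbf{X})=0).$$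 A sequence of tests (indexed by $n$) is asymptotically powerful if $\limsup_{n\to\infty}\mathrm{Risk}(T)=0$. All asymptotics are as $n\to\infty$; $a_n\gg b_n$ means $b_n=o(a_n)$. *)

(* Defs.v *)
From mathcomp Require Import all_boot all_order all_algebra.
From mathcomp Require Import all_classical all_reals all_analysis.
Set Implicit Arguments.
Unset Strict Implicit.
Unset Printing Implicit Defensive.
Import Order.TTheory GRing.Theory Num.Theory.
Import numFieldNormedType.Exports.
Local Open Scope classical_set_scope.
Local Open Scope ring_scope.

Definition tanh (R : realType) (x : R) : R :=
  (expR x - expR (- x)) / (expR x + expR (- x)).

(* The norm `|.| of a column vector is its largest absolute entry. *)
Definition opnorm_infty (R : realType) (n : nat) (A : 'M[R]_n) : R :=
  sup [set `|A *m x| | x in [set x : 'cV[R]_n | `|x| <= 1]].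

Definition hollow (R : realType) (n : nat) (A : 'M[R]_n) : Prop :=
  forall i, A i i = 0.

(* A configuration in {-1, +1}^n is coded by booleans, true standing for +1;
   [spins] is the corresponding real vector. *)
Definition config (n : nat) : finType := {ffun 'I_n -> bool}.

Definition spins (R : realType) (n : nat) (x : config n) : 'cV[R]_n :=
  \col_i (if x i then 1 else -1).

Section Ising.
Context {R : realType} {n : nat}.
Implicit Types (Q : 'M[R]_n) (mu : 'cV[R]_n) (x : config n).

Definition ising_weight Q mu x : R :=
  let v := spins R x in
  expR (2^-1 * (v^T *m Q *m v) 0 0 + (mu^T *m v) 0 0).

Definition ising_Z Q mu : R := \sum_x ising_weight Q mu x.

Definition ising_pmf Q mu x : R := ising_weight Q mu x / ising_Z Q mu.

Definition ising_prob Q mu (E : pred (config n)) : R :=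
  \sum_(x | E x) ising_pmf Q mu x.

Definition supp mu : {set 'I_n} := [set i | mu i 0 != 0]%SET.

Definition Xi (s : nat) (B : R) : set 'cV[R]_n :=
  [set mu | #|supp mu| = s /\ forall i, i \in supp mu -> B <= mu i 0].

Definition risk Q (s : nat) (B : R) (T : config n -> bool) : R :=
  ising_prob Q 0 (fun x => T x)
  + sup [set ising_prob Q mu (fun x => ~~ T x) | mu in Xi s B].

Definition local_field Q x (i : 'I_n) : R := \sum_j Q i j * spins R x j 0.

Definition tildeX Q x : R :=
  n%:R^-1 * \sum_i (spins R x i 0 - tanh (local_field Q x i)).

Definition tildeX_test Q (L : R) : config n -> bool :=
  fun x => L <= Num.sqrt n%:R * tildeX Q x.

End Ising.

Definition asymptotically_powerful (R : realType) (Q : forall n, 'M[R]_n)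
    (s : nat -> nat) (B : nat -> R) (T : forall n, config n -> bool) : Prop :=
  limn_esup (fun n => (risk (Q n) (s n) (B n) (T n))%:E) = 0%E.

Section SanityChecks.
Context {R : realType} {n : nat}.

Lemma ising_Z_gt0 (Q : 'M[R]_n) mu : 0 < ising_Z Q mu.
Proof.
rewrite /ising_Z (bigD1 [ffun=> true]) //=.
by rewrite ltr_pwDl ?expR_gt0// sumr_ge0// => x _; exact: expR_ge0.
Qed.

Lemma ising_prob_total (Q : 'M[R]_n) mu : ising_prob Q mu predT = 1.
Proof.
by rewrite /ising_prob -mulr_suml divff// gt_eqF// ising_Z_gt0.
Qed.

Lemma opnorm_inftyE (A : 'M[R]_n) :
  opnorm_infty A = \big[Num.max/0]_i \sum_j `|A i j|.
Proof.
set M := RHS.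
have normP (v : 'cV[R]_n) (c : R) : 0 <= c ->
    (`|v| <= c) <-> (forall i, `|v i 0| <= c).
  move=> c0; rewrite [`|v|]mx_normrE; split => [/bigmax_leP[_ h] i|h].
    exact: (h (i, 0)).
  by apply/bigmax_leP; split => // -[i j] _ /=; rewrite (ord1 j).
have M0 : 0 <= M by exact: bigmax_ge_id.
have ub : ubound [set `|A *m x| | x in [set x : 'cV[R]_n | `|x| <= 1]] M.
  move=> _ [x /= /(normP _ _ ler01) x1 <-].
  apply/normP => // i; rewrite mxE.
  apply: le_trans (le_bigmax _ (fun i => \sum_j `|A i j|) i).
  apply: le_trans (ler_norm_sum _ _ _) _; apply: ler_sum => j _.
  by rewrite normrM ler_piMr.
have ne : [set `|A *m x| | x in [set x : 'cV[R]_n | `|x| <= 1]] !=set0.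
  by exists `|A *m (0 : 'cV[R]_n)|; exists 0 => //=; rewrite normr0.
apply/eqP; rewrite eq_le; apply/andP; split; first exact: ge_sup.
have hs : has_ubound [set `|A *m x| | x in [set x : 'cV[R]_n | `|x| <= 1]].
  by exists M.
apply/bigmax_leP; split => [|i _].
  by apply: (ub_le_sup hs); exists 0; rewrite /= ?normr0// mulmx0 normr0.
pose x : 'cV[R]_n := \col_j Num.sg (A i j).
apply: (@le_trans _ _ `|A *m x|).
  apply: le_trans (iffLR (normP (A *m x) _ (normr_ge0 _)) (lexx _) i).
  rewrite mxE (le_trans _ (ler_norm _))// ler_sum// => j _.
  by rewrite mxE [leRHS]mulrC -normrEsg.
apply: (ub_le_sup hs); exists x => //=.
apply/normP => // j; rewrite mxE normr_sg.
by case: eqP.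
Qed.

End SanityChecks.

(* Main.v *)
Require Import Defs.
From mathcomp Require Import all_boot all_order all_algebra.
From mathcomp Require Import all_classical all_reals all_analysis.
From mathcomp Require Import ring lra.
Set Implicit Arguments.
Unset Strict Implicit.
Unset Printing Implicit Defensive.
Import Order.TTheory GRing.Theory Num.Theory.
Import numFieldNormedType.Exports.
Local Open Scope classical_set_scope.
Local Open Scope ring_scope.

(* Write D_i = X_i - tanh (m_i + mu_i).  Flipping spin i shows that D_i is
   orthogonal to every function of the other spins, and D_j depends on spin i
   only through Q_ji (or through X_i when i = j), so that
   E[D_i D_j] <= 2 [i = j] + 8 |Q_ji| and E[(\sum_i D_i)^2] = O(n) for every mu.
   Under H_0, sqrt n times tilde X is \sum_i D_i / sqrt n, and Chebyshev bounds
   the type I error by O(1 / L^2).  Under H_1 the statistic n tilde X exceeds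
   \sum_i D_i by at least (1 - tanh K) s tanh B, where K bounds the norm of Q
   and hence every |m_i|, and Chebyshev bounds the type II error by
   O(n / (s tanh B)^2). *)

(** * Elementary inequalities for the hyperbolic tangent *)

Section Tanh.
Context {R : realType}.
Implicit Types a b x : R.

Let cosh2_gt0 x : 0 < expR x + expR (- x).
Proof. by rewrite addr_gt0 ?expR_gt0. Qed.

Lemma tanhN x : tanh (- x) = - tanh x.
Proof. by rewrite /tanh opprK -mulNr opprB [expR x + _]addrC. Qed.

Lemma tanh_lt1 x : tanh x < 1.
Proof.
rewrite /tanh ltr_pdivrMr// mul1r.
by have := expR_gt0 (- x); lra.
Qed.

Lemma tanh_gtN1 x : -1 < tanh x.
Proof. by rewrite ltrNl -tanhN tanh_lt1. Qed.

(** The subtraction formula cleared of its denominator; monotonicity, the Lipschitz bound and the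
    shift bound follow from it without derivatives. *)
Lemma tanhB a b : tanh b - tanh a = tanh (b - a) * (1 - tanh a * tanh b).
Proof.
rewrite /tanh opprB !expRD !expRN.
have ea := expR_gt0 a; have eb := expR_gt0 b.
set u := expR a in ea *; set v := expR b in eb *.
have sq (y z : R) : 0 < y -> 0 < z -> y * y + z * z != 0.
  by move=> y0 z0; rewrite gt_eqF// addr_gt0 ?mulr_gt0.
have sq1 (y : R) : 0 < y -> y * y + 1 != 0.
  by move=> y0; rewrite -[X in _ + X]mulr1 sq.
by field; rewrite !sq1// !sq// !gt_eqF.
Qed.

Lemma tanh_le_mul2 x : 0 <= x -> tanh x <= 2 * x.
Proof.
move=> x0; rewrite /tanh ler_pdivrMr//.
have ex := expR_gt0 x; have exN := expR_gt0 (- x).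
(* This is exp (- 2 x) >= 1 - 2 x multiplied by exp x; the factor 2 of the lemma comes from here. *)
have h : expR x * (1 - 2 * x) <= expR (- x).
  have -> : expR (- x) = expR x * expR (- 2 * x).
    by rewrite -expRD; congr expR; ring.
  by rewrite ler_pM2l//; have := expR_ge1Dx (- 2 * x); rewrite mulNr.
have : 0 <= 2 * x * expR (- x) by rewrite !mulr_ge0// ltW.
lra.
Qed.

Lemma tanh_ge0 x : 0 <= x -> 0 <= tanh x.
Proof.
by move=> x0; rewrite divr_ge0 ?(ltW (cosh2_gt0 _))// subr_ge0 ler_expR; lra.
Qed.

Lemma tanh_gt0 x : 0 < x -> 0 < tanh x.
Proof.
by move=> x0; rewrite divr_gt0// subr_gt0 ltr_expR; lra.
Qed.

Let tanh_prod a b : 0 <= 1 - tanh a * tanh b <= 2.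
Proof.
have := tanh_lt1 a; have := tanh_gtN1 a; have := tanh_lt1 b; have := tanh_gtN1 b.
by move=> *; apply/andP; split; nra.
Qed.

Lemma le_tanh a b : a <= b -> tanh a <= tanh b.
Proof.
move=> ab; rewrite -subr_ge0 tanhB mulr_ge0 ?tanh_ge0 ?subr_ge0//.
by case/andP: (tanh_prod a b); rewrite subr_ge0.
Qed.

(** The constant is 2 from [tanh_le_mul2] times 2, the bound on the second factor in [tanhB]. *)
Lemma tanh_lipschitz a b : `|tanh a - tanh b| <= 4 * `|a - b|.
Proof.
wlog ab : a b / b <= a.
  move=> H; case: (leP b a) => [|/ltW] /H//.
  by rewrite distrC [`|b - a|]distrC.
rewrite !ger0_norm ?subr_ge0 ?le_tanh// tanhB.
have d0 : 0 <= a - b by rewrite subr_ge0.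
have := tanh_le_mul2 d0; have := tanh_ge0 d0.
have /andP[] := tanh_prod b a.
set p := 1 - _; set t := tanh _ => p0 p2 t0 tle.
have : t * p <= (2 * (a - b)) * 2 by apply: ler_pM.
lra.
Qed.

(** By monotonicity x may be lowered to b; then [tanhB] applies, with tanh a * tanh (a + b) <= |tanh
    a| <= tanh K. *)
Lemma tanh_shift a b x K : `|a| <= K -> 0 <= b -> b <= x ->
  (1 - tanh K) * tanh b <= tanh (a + x) - tanh a.
Proof.
move=> aK b0 bx.
have ab : tanh (a + b) <= tanh (a + x) by rewrite le_tanh// lerD2l.
apply: le_trans (_ : tanh (a + b) - tanh a <= _); last by rewrite lerB.
rewrite tanhB [a + b - a]addrAC subrr add0r mulrC ler_wpM2l ?tanh_ge0// lerB//.
have := tanh_lt1 (a + b); have := tanh_gtN1 (a + b).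
move: aK; rewrite ler_norml => /andP[/le_tanh + /le_tanh].
by rewrite tanhN; set u := tanh a; set v := tanh (_ + _) => *; nra.
Qed.

End Tanh.

(** * Spin flips and conditionally centred spins *)

Section GlauberFlip.
Context {R : realType} {n : nat}.
Implicit Types (Q : 'M[R]_n) (mu : 'cV[R]_n) (x : config n) (i j : 'I_n).

Definition flip i x : config n := [ffun j => if j == i then ~~ x j else x j].

Lemma flipK i : involutive (flip i).
Proof.
by move=> x; apply/ffunP => j; rewrite !ffunE; case: eqP => //; rewrite negbK.
Qed.

Lemma spinsE x i : spins R x i 0 = if x i then 1 else -1.
Proof. by rewrite mxE. Qed.

Lemma spins_flip i x :
  spins R (flip i x) = spins R x - (2 * spins R x i 0) *: delta_mx i 0.
Proof.
apply/colP => j; rewrite !mxE ffunE eqxx andbT.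
by case: eqVneq => [->|_]; [case: (x i) => /=; lra|rewrite mulr0 subr0].
Qed.

Lemma local_fieldE Q x i : local_field Q x i = (Q *m spins R x) i 0.
Proof. by rewrite mxE. Qed.

Lemma local_field_flip Q x i j :
  local_field Q (flip i x) j = local_field Q x j - 2 * spins R x i 0 * Q j i.
Proof.
by rewrite !local_fieldE spins_flip mulmxBr -scalemxAr -colE !mxE.
Qed.

(** Symmetry makes the two cross terms equal, and the term in a^2 carries the zero diagonal entry of
    Q. *)
Lemma quad_form_sub_delta Q (v : 'cV[R]_n) i a : Q^T = Q -> hollow Q ->
  ((v - a *: delta_mx i 0)^T *m Q *m (v - a *: delta_mx i 0)) 0 0
  = (v^T *m Q *m v) 0 0 - 2 * a * (Q *m v) i 0.
Proof.
move=> Qs Qh.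
have -> : (v - a *: delta_mx i 0)^T = v^T - a *: delta_mx 0 i.
  by rewrite linearB /= linearZ /= trmx_delta.
rewrite !mulmxBl !mulmxBr.
rewrite -!scalemxAl -!scalemxAr.
have e1 : (delta_mx (0 : 'I_1) i *m Q *m v) 0 0 = (Q *m v) i 0.
  by rewrite -mulmxA -rowE mxE.
have e2 : (v^T *m Q *m delta_mx i (0 : 'I_1)) 0 0 = (Q *m v) i 0.
  by rewrite -colE mxE -{1}Qs -trmx_mul mxE.
have e3 : (delta_mx (0 : 'I_1) i *m Q *m delta_mx i (0 : 'I_1)) 0 0 = 0.
  by rewrite -rowE -colE !mxE Qh.
move: e1 e2 e3.
set A := v^T *m Q *m v; set C := v^T *m Q *m _; set D := _ *m v.
set E := delta_mx 0 i *m Q *m _; move: A C D E => A C D E e1 e2 e3.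
rewrite !(mxE, e1, e2, e3); lra.
Qed.

(** These are the conditional odds of spin i given the others, so its conditional mean is tanh (m_i
    + mu_i). *)
Lemma ising_weight_flip Q mu x i : Q^T = Q -> hollow Q ->
  ising_weight Q mu x = ising_weight Q mu (flip i x) *
    expR (2 * spins R x i 0 * (local_field Q x i + mu i 0)).
Proof.
move=> Qs Qh; rewrite /ising_weight -expRD spins_flip; congr expR.
rewrite quad_form_sub_delta// mulmxBr -scalemxAr -colE -local_fieldE.
move: (spins R x i 0) (local_field Q x i) => c m.
set q := (_ *m _ *m _) 0 0; move: q (mu^T *m _) => q A; rewrite !mxE; lra.
Qed.

(** The D_i of the overview: spin i minus its conditional mean given the other spins. *)
Definition residual Q mu i x : R :=
  spins R x i 0 - tanh (local_field Q x i + mu i 0).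

Lemma residual_norm_le2 Q mu i x : `|residual Q mu i x| <= 2.
Proof.
rewrite /residual spinsE; set t := tanh _.
have t1 : t < 1 := tanh_lt1 _; have tN1 : -1 < t := tanh_gtN1 _.
by rewrite ler_norml; case: ifP => _; lra.
Qed.

(** The field a = m_i + mu_i is unchanged by the flip, as Q is hollow, and exp a * (1 - tanh a) =
    exp (- a) * (1 + tanh a). *)
Lemma residual_flip_balance Q mu i x : Q^T = Q -> hollow Q ->
  ising_weight Q mu x * residual Q mu i x
  + ising_weight Q mu (flip i x) * residual Q mu i (flip i x) = 0.
Proof.
move=> Qs Qh; rewrite (ising_weight_flip mu x i Qs Qh) -mulrA -mulrDr.
rewrite /residual local_field_flip Qh mulr0 subr0 !spinsE ffunE eqxx.
set a := local_field _ _ _ + _; rewrite /tanh.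
apply/eqP; rewrite mulf_eq0; apply/orP; right; apply/eqP.
have e0 := expR_gt0 a.
have d0 : expR a * expR a + 1 != 0 by rewrite gt_eqF// addr_gt0// mulr_gt0.
have e2 : expR (2 * a) = expR a * expR a by rewrite -expRD; congr expR; ring.
case: (x i) => /=; rewrite ?mulrN mulr1 ?mulNr ?[expR (- (2 * a))]expRN e2 expRN.
  by field; rewrite d0 gt_eqF.
by field; rewrite d0 gt_eqF.
Qed.

(** * Moments of the residuals and Chebyshev's inequality *)

Definition ising_mean Q mu (f : config n -> R) : R :=
  \sum_x ising_pmf Q mu x * f x.

Lemma ising_pmf_ge0 Q mu x : 0 <= ising_pmf Q mu x.
Proof. by rewrite divr_ge0 ?expR_ge0// ltW// ising_Z_gt0. Qed.

Lemma ising_mean_residual_flip_invariant Q mu i (g : config n -> R) :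
  Q^T = Q -> hollow Q -> (forall x, g (flip i x) = g x) ->
  ising_mean Q mu (fun x => residual Q mu i x * g x) = 0.
Proof.
move=> Qs Qh gi; rewrite /ising_mean; set S := \sum_x _.
(* Reindexing one copy by the flip pairs each x with [flip i x], and each pair cancels. *)
have : S + S = 0.
  rewrite {2}/S (reindex_inj (inv_inj (flipK i))) -big_split big1//= => x _.
  rewrite gi /ising_pmf.
  transitivity ((ising_weight Q mu x * residual Q mu i x
    + ising_weight Q mu (flip i x) * residual Q mu i (flip i x))
    * ((ising_Z Q mu)^-1 * g x)); first by ring.
  by rewrite residual_flip_balance// mul0r.
by move=> h; lra.
Qed.

(** The jump of X_j gives 2 when i = j; m_j moves by 2 |Q_ji|, which the Lipschitz constant 4 turns
    into 8 |Q_ji|. *)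
Lemma residual_flip_diff Q mu i j x :
  `|residual Q mu j x - residual Q mu j (flip i x)| <=
  2 * (i == j)%:R + 8 * `|Q j i|.
Proof.
rewrite /residual.
set s1 := spins R x j 0; set s2 := spins R (flip i x) j 0.
set t1 := tanh _; set t2 := tanh _.
have -> : s1 - t1 - (s2 - t2) = (s1 - s2) - (t1 - t2) by ring.
apply: le_trans (ler_normB _ _) _; apply: lerD.
  rewrite /s1 /s2 !spinsE ffunE eq_sym; case: eqP => _; case: (x j) => /=;
  by rewrite ler_norml; apply/andP; split; lra.
apply: le_trans (tanh_lipschitz _ _) _.
rewrite local_field_flip.
set u := _ - _; have -> : u = 2 * spins R x i 0 * Q j i by rewrite /u; ring.
rewrite !normrM spinsE (_ : `|if x i then 1 else -1 : R| = 1) ?mulr1.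
  by rewrite normr_nat; lra.
by case: ifP; rewrite ?normrN normr1.
Qed.

(* [residual i] is orthogonal to every function that does not depend on spin
   [i], so only the dependence of [residual j] on spin [i] contributes. *)
Lemma residual_covariance Q mu i j : Q^T = Q -> hollow Q ->
  ising_mean Q mu (fun x => residual Q mu i x * residual Q mu j x) <=
  2 * (i == j)%:R + 8 * `|Q j i|.
Proof.
move=> Qs Qh; set c := _ + _.
(* The flip-invariant part of D_j: the remainder is half the flip difference, and this half cancels
   the bound 2 on |D_i|. *)
pose g x := 2^-1 * (residual Q mu j x + residual Q mu j (flip i x)).
have gi x : g (flip i x) = g x by rewrite /g flipK addrC.
rewrite -[leRHS]addr0 -(ising_mean_residual_flip_invariant mu Qs Qh gi).
rewrite -[c]mulr1 -(ising_prob_total Q mu) /ising_prob mulr_sumr -big_split /=.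
apply: ler_sum => x _; rewrite [c * _]mulrC -mulrDr ler_wpM2l ?ising_pmf_ge0//.
rewrite -lerBlDr -mulrBr.
apply: le_trans (ler_norm _) _; rewrite normrM.
have -> : residual Q mu j x - g x =
    2^-1 * (residual Q mu j x - residual Q mu j (flip i x)).
  by rewrite /g; lra.
rewrite normrM (ger0_norm (_ : 0 <= 2^-1 :> R)) ?invr_ge0//.
have d := residual_flip_diff Q mu i j x.
have r := residual_norm_le2 Q mu i x.
apply: le_trans (_ : 2 * (2^-1 * c) <= _); last by lra.
by apply: ler_pM; rewrite ?mulr_ge0 ?invr_ge0// ler_wpM2l ?invr_ge0.
Qed.

Lemma sum_residual_second_moment Q mu K : Q^T = Q -> hollow Q ->
  (forall i, \sum_j `|Q i j| <= K) ->
  ising_mean Q mu (fun x => (\sum_i residual Q mu i x) ^+ 2) <=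
  (2 + 8 * K) * n%:R.
Proof.
move=> Qs Qh QK.
have -> : ising_mean Q mu (fun x => (\sum_i residual Q mu i x) ^+ 2) =
   \sum_j \sum_i ising_mean Q mu (fun x => residual Q mu i x * residual Q mu j x).
  rewrite /ising_mean; under [RHS]eq_bigr do rewrite exchange_big /=.
  rewrite exchange_big; apply: eq_bigr => x _.
  rewrite expr2 mulr_sumr mulr_sumr; apply: eq_bigr => j _.
  by rewrite mulr_suml mulr_sumr.
(* With j fixed, the sum over i runs along row j of Q and costs at most 2 + 8 K. *)
rewrite mulr_natr -[n in _ *+ n]card_ord -sumr_const; apply: ler_sum => j _.
apply: le_trans (ler_sum _ (fun i _ => residual_covariance mu i j Qs Qh)) _.
rewrite big_split /= -!mulr_sumr (bigD1 j)//= eqxx big1 ?addr0; last first.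
  by move=> i /negbTE->.
by rewrite mulr1 lerD2l ler_wpM2l.
Qed.

Lemma ising_prob_chebyshev Q mu (f : config n -> R) (E : pred (config n)) a :
  0 < a -> (forall x, E x -> a <= `|f x|) ->
  ising_prob Q mu E <= ising_mean Q mu (fun x => f x ^+ 2) / a ^+ 2.
Proof.
move=> a0 Ea; rewrite ler_pdivlMr ?exprn_gt0// /ising_prob mulr_suml /ising_mean.
rewrite [leRHS](bigID E) /= -[leLHS]addr0; apply: lerD.
  apply: ler_sum => x /Ea ax; rewrite ler_wpM2l ?ising_pmf_ge0//.
  by rewrite -[f x ^+ 2]real_normK ?num_real// ler_pXn2r ?nnegrE// ltW.
by apply: sumr_ge0 => x _; rewrite mulr_ge0 ?ising_pmf_ge0 ?sqr_ge0.
Qed.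

End GlauberFlip.

(** * Error bounds at fixed n *)

Section RiskBound.
Context {R : realType} {n : nat}.
Variables (Q : 'M[R]_n) (K : R).
Hypotheses (Q_sym : Q^T = Q) (Q_hollow : hollow Q)
  (Q_row : forall i, \sum_j `|Q i j| <= K).
Implicit Types (mu : 'cV[R]_n) (x : config n).

Lemma local_field_norm x i : `|local_field Q x i| <= K.
Proof.
apply: le_trans (ler_norm_sum _ _ _) _; apply: le_trans (Q_row i).
apply: ler_sum => j _; rewrite normrM spinsE.
by case: ifP; rewrite ?normrN normr1 mulr1.
Qed.

Lemma sqrtn_tildeX x : (0 < n)%N ->
  Num.sqrt n%:R * tildeX Q x =
  (\sum_i residual Q 0 i x) / Num.sqrt n%:R.
Proof.
move=> n0; rewrite /tildeX mulrA mulrC; congr (_ * _).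
  by apply: eq_bigr => i _; rewrite /residual [(0 : 'cV__) _ _]mxE addr0.
have s0 : Num.sqrt n%:R != 0 :> R by rewrite gt_eqF// sqrtr_gt0 ltr0n.
by rewrite -{2}[n%:R](@sqr_sqrtr R) ?ler0n// expr2 invfM mulrA divff// mul1r.
Qed.

Lemma ising_prob_sum_residual mu (E : pred (config n)) a : 0 < a ->
  (forall x, E x -> a <= `|\sum_i residual Q mu i x|) ->
  ising_prob Q mu E <= (2 + 8 * K) * n%:R / a ^+ 2.
Proof.
move=> a0 Ea; apply: le_trans (ising_prob_chebyshev Q mu a0 Ea) _.
by rewrite ler_wpM2r ?invr_ge0 ?sqr_ge0// sum_residual_second_moment.
Qed.

Lemma type1_error_le L : (0 < n)%N -> 0 < L ->
  ising_prob Q 0 (tildeX_test Q L) <= (2 + 8 * K) / L ^+ 2.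
Proof.
move=> n0 L0; have s0 : 0 < Num.sqrt n%:R :> R by rewrite sqrtr_gt0 ltr0n.
have -> : (2 + 8 * K) / L ^+ 2 =
    (2 + 8 * K) * n%:R / (L * Num.sqrt n%:R) ^+ 2.
  rewrite exprMn sqr_sqrtr ?ler0n// [(_ * n%:R)^-1]invfM mulrACA divff ?mulr1//.
  by rewrite pnatr_eq0 -lt0n.
apply: ising_prob_sum_residual; first by rewrite mulr_gt0.
move=> x; rewrite /tildeX_test sqrtn_tildeX// ler_pdivlMr// => h.
exact: le_trans h (ler_norm _).
Qed.

(** Each coordinate contributes tanh (m_i + mu_i) - tanh m_i: zero off the support, and bounded
    below by [tanh_shift] on it. *)
Lemma residual_sum_shift mu x s B : 0 <= B -> Xi s B mu ->
  (1 - tanh K) * (s%:R * tanh B) <=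
  \sum_i residual Q 0 i x - \sum_i residual Q mu i x.
Proof.
move=> B0 [/= <- muB].
rewrite mulrCA mulrC mulr_natr -sumr_const -sumrB big_mkcond /=.
apply: ler_sum => i _; case: ifPn => isupp.
  apply: le_trans (tanh_shift (local_field_norm x i) B0 (muB _ isupp)) _.
  by rewrite /residual [(0 : 'cV__) _ _]mxE addr0; lra.
have /eqP mu0 : mu i 0 == 0 by move: isupp; rewrite inE negbK.
by rewrite /residual mu0 [(0 : 'cV__) _ _]mxE subrr.
Qed.

(** Half of the shift absorbs the threshold; on acceptance the centred sum must then fall below
    minus the other half. *)
Lemma type2_error_le mu s B L : (0 < n)%N -> (0 < s)%N -> 0 < B -> Xi s B mu ->
  Num.sqrt n%:R * L <= (1 - tanh K) / 2 * (s%:R * tanh B) ->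
  ising_prob Q mu (fun x => ~~ tildeX_test Q L x) <=
  (2 + 8 * K) * n%:R / ((1 - tanh K) / 2 * (s%:R * tanh B)) ^+ 2.
Proof.
move=> n0 s0 B0 muXi Lle.
have q0 : 0 < Num.sqrt n%:R :> R by rewrite sqrtr_gt0 ltr0n.
apply: ising_prob_sum_residual.
  rewrite mulr_gt0 ?divr_gt0 ?subr_gt0 ?tanh_lt1//.
  by rewrite mulr_gt0 ?ltr0n ?tanh_gt0.
move=> x; rewrite /tildeX_test sqrtn_tildeX// -ltNge ltr_pdivrMr// => h.
have := residual_sum_shift x (ltW B0) muXi.
rewrite -normrN => H; apply: le_trans (ler_norm _).
lra.
Qed.

Lemma risk_ge0 s B (T : config n -> bool) : 0 <= risk Q s B T.
Proof.
have pge0 mu E : 0 <= ising_prob Q mu E.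
  by apply: sumr_ge0 => x _; exact: ising_pmf_ge0.
rewrite addr_ge0//; set S := [set _ | _ in _].
(* If [Xi s B] is empty, the supremum takes its default value 0. *)
have [->|/set0P[p Sp]] := eqVneq S set0; first by rewrite sup0.
apply: le_trans (_ : p <= _); first by case: Sp => mu _ <-.
apply: ub_le_sup Sp; exists 1 => _ [mu _ <-].
rewrite -(ising_prob_total Q mu) /ising_prob [leRHS](bigID (fun x => ~~ T x)) /=.
by rewrite lerDl sumr_ge0// => x _; exact: ising_pmf_ge0.
Qed.

Lemma risk_le s B L : (0 < n)%N -> (0 < s)%N -> 0 < B -> 0 < L -> 0 <= K ->
  Num.sqrt n%:R * L <= (1 - tanh K) / 2 * (s%:R * tanh B) ->
  risk Q s B (tildeX_test Q L) <=
  (2 + 8 * K) / L ^+ 2 +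
  (2 + 8 * K) * n%:R / ((1 - tanh K) / 2 * (s%:R * tanh B)) ^+ 2.
Proof.
move=> n0 s0 B0 L0 K0 Lle; rewrite /risk lerD ?type1_error_le//.
set S := [set _ | _ in _]; have [->|/set0P S0] := eqVneq S set0.
  by rewrite sup0 divr_ge0 ?sqr_ge0// mulr_ge0// addr_ge0// mulr_ge0.
by apply: ge_sup S0 _ => _ [mu muXi <-]; exact: type2_error_le.
Qed.

End RiskBound.

(** * Passage to the limit *)

Theorem theorem4 (R : realType) (Q : forall n, 'M[R]_n)
    (s : nat -> nat) (B L : nat -> R)
    (Q_sym : forall n, (Q n)^T = Q n)
    (Q_hollow : forall n, hollow (Q n))
    (Q_bounded : (fun n => opnorm_infty (Q n)) =O_\oo (fun=> 1 : R))
    (s_range : forall n, (0 < n)%N -> (1 <= s n <= n)%N)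
    (B_gt0 : forall n, (0 < n)%N -> 0 < B n)
    (signal : (fun n => Num.sqrt n%:R) =o_\oo (fun n => (s n)%:R * tanh (B n)))
    (L_infty : L @ \oo --> +oo)
    (L_small : L =o_\oo
       (fun n => (Num.sqrt n%:R)^-1 * ((s n)%:R * tanh (B n)))) :
  asymptotically_powerful Q s B (fun n => tildeX_test (Q n) (L n)).
Proof.
have [K K0 Qle] : exists2 K, 0 < K & \forall n \near \oo,
    forall i, \sum_j `|Q n i j| <= K.
  have [K K0 HK] := (eqO_exP _ _ _).1 Q_bounded; exists K => //.
  near=> n => i.
  have : `|opnorm_infty (Q n)| <= K * `|1 : R| by near: n; exact: HK.
  rewrite normr1 mulr1 => /(le_trans (ler_norm _)); apply: le_trans.
  by rewrite opnorm_inftyE; exact: (le_bigmax _ (fun i => \sum_j `|Q n i j|)).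
pose c := (1 - tanh K) / 2; pose C := 2 + 8 * K.
have c0 : 0 < c by rewrite divr_gt0// subr_gt0 tanh_lt1.
have C0 : 0 < C by rewrite addr_gt0// mulr_gt0.
(* It is enough that the real-valued risk converges to 0. *)
apply: (cvg_limn_einf_sup _).2; apply: cvg_EFin; first exact: nearW.
apply/cvgrPdist_le => e e0.
(* Chosen so that C d^2 = e / 2, the share of each type of error. *)
pose d := Num.sqrt (e / 2 / C).
have d0 : 0 < d by rewrite sqrtr_gt0 !divr_gt0.
have d2 : C * d ^+ 2 = e / 2.
  by rewrite sqr_sqrtr ?ltW ?divr_gt0// mulrC divfK ?gt_eqF.
near=> n.
have n0 : (0 < n)%N by near: n; exact: nbhs_infty_gt.
have q0 : 0 < Num.sqrt n%:R :> R by rewrite sqrtr_gt0 ltr0n.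
have /andP[s0 _] := s_range _ n0; have Bn0 := B_gt0 _ n0.
have A0 : 0 < (s n)%:R * tanh (B n) by rewrite mulr_gt0 ?ltr0n ?tanh_gt0.
have dL : d^-1 <= L n by near: n; move/cvgryPge : L_infty; apply.
have L0 : 0 < L n by rewrite (lt_le_trans _ dL)// invr_gt0.
(* [L_small] with constant c keeps the threshold below half of the shift. *)
have LA : Num.sqrt n%:R * L n <= c * ((s n)%:R * tanh (B n)).
  have : `|L n| <= c * `|(Num.sqrt n%:R)^-1 * ((s n)%:R * tanh (B n))|.
    by near: n; exact: ((eqoP _ _ _).1 L_small).
  rewrite (gtr0_norm L0) gtr0_norm; last by rewrite mulr_gt0 ?invr_gt0.
  by rewrite mulrCA ler_pdivlMl.
(* The constant d * c makes the type II bound at most C d^2. *)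
have nA : Num.sqrt n%:R <= d * c * ((s n)%:R * tanh (B n)).
  have : `|Num.sqrt n%:R : R| <= d * c * `|(s n)%:R * tanh (B n)|.
    by near: n; apply: ((eqoP _ _ _).1 signal); rewrite mulr_gt0.
  by rewrite (gtr0_norm q0) (gtr0_norm A0).
rewrite sub0r normrN ger0_norm ?risk_ge0//=.
have Qn : forall i, \sum_j `|Q n i j| <= K by near: n.
apply: le_trans (risk_le (Q_sym n) (Q_hollow n) Qn n0 s0 Bn0 L0 (ltW K0) LA) _.
rewrite -/c -/C [e](_ : _ = e / 2 + e / 2); last by lra.
rewrite -d2; apply: lerD; last rewrite -[leLHS]mulrA; rewrite ler_pM2l//.
  rewrite -exprVn ler_pXn2r ?nnegrE ?invr_ge0 ?(ltW L0) ?(ltW d0)//.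
  by rewrite -[leRHS]invrK lef_pV2 ?posrE ?invr_gt0.
have X0 : 0 < c * ((s n)%:R * tanh (B n)) by rewrite mulr_gt0.
rewrite ler_pdivrMr ?exprn_gt0// -exprMn mulrA.
rewrite -[n%:R](@sqr_sqrtr R) ?ler0n// ler_pXn2r// nnegrE ltW//.
by rewrite -mulrA mulr_gt0.
Unshelve. all: by end_near.
Qed.
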